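(* Let $(R,\mathfrak m)$ be a local integral domain and let $f\in R$ be nonzero. Let $\zeta: 0\to R\to \mathcal A\to R_f\to 0$ be a short exact sequence of $R$-modules such that $\mathcal A$ decomposes as a direct sum of two nonzero $R$-modules. Then $\zeta$ splits.
   Context: Rings are commutative and noetherian. $R_f$ denotes the localization of $R$ at the powers of $f$. The module $\mathcal A$ is not assumed finitely generated. *)

(* Defs.v *)
From HB Require Import structures.
From mathcomp Require Import all_boot all_algebra.
From mathcomp Require Import generic_quotient.
From mathcomp Require Import boolp classical_sets.
From mathcomp Require Import ring.

Set Implicit Arguments.
Unset Strict Implicit.
Unset Printing Implicit Defensive.

Import GRing.Theory.
Local Open Scope ring_scope.
Local Open Scope quotient_scope.

Section Ideals.
Variable R : comNzRingType.
Implicit Types I J m : set R.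

Definition is_ideal I : Prop :=
  [/\ I 0, (forall x y, I x -> I y -> I (x + y)) & (forall a x, I x -> I (a * x))].

Definition is_maximal_ideal m : Prop :=
  [/\ is_ideal m, m <> [set: R]%classic
    & forall J, is_ideal J -> (m `<=` J)%classic -> J = m \/ J = [set: R]%classic].

Definition is_local_ring m : Prop :=
  is_maximal_ideal m /\ (forall n, is_maximal_ideal n -> n = m).

Definition ideal_span (s : seq R) : set R :=
  [set x | exists c : 'I_(size s) -> R, x = \sum_(i < size s) c i * s`_i]%classic.

End Ideals.

Definition noetherian (R : comNzRingType) : Prop :=
  forall I : set R, is_ideal I -> exists s : seq R, I = ideal_span s.

(* The localization R_f: a pair (a, n) stands for the fraction a / f ^+ n.    *)
(* It is a commutative ring (zero when f is nilpotent) and an R-module.       *)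
Section Localization.
Variables (R : comNzRingType) (f : R).
Implicit Types x y z : R * nat.

Definition loc_equiv x y : bool :=
  `[< exists k, f ^+ k * (x.1 * f ^+ y.2) = f ^+ k * (y.1 * f ^+ x.2) >].

Lemma loc_equiv_refl : reflexive loc_equiv.
Proof. by move=> x; apply/asboolP; exists 0. Qed.

Lemma loc_equiv_sym : symmetric loc_equiv.
Proof. by move=> x y; apply/asboolP/asboolP => -[k ek]; exists k. Qed.

Lemma loc_equiv_trans : transitive loc_equiv.
Proof.
move=> [b n] [a m] [c p] /asboolP[k /= ek] /asboolP[l /= el].
apply/asboolP; exists (k + l + n)%N => /=; rewrite !exprD.
have -> : f ^+ k * f ^+ l * f ^+ n * (a * f ^+ p) =
  f ^+ l * f ^+ p * (f ^+ k * (a * f ^+ n)) by ring.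
have -> : f ^+ k * f ^+ l * f ^+ n * (c * f ^+ m) =
  f ^+ k * f ^+ m * (f ^+ l * (c * f ^+ n)) by ring.
by rewrite ek -el; ring.
Qed.

Canonical loc_equiv_equiv :=
  EquivRel loc_equiv loc_equiv_refl loc_equiv_sym loc_equiv_trans.

Definition localization := {eq_quot loc_equiv}.

HB.instance Definition _ : EqQuotient _ loc_equiv localization :=
  EqQuotient.on localization.
HB.instance Definition _ := Choice.on localization.

Definition loc_frac (a : R) (n : nat) : localization := \pi_localization (a, n).

Lemma loc_fracP (q : localization) : exists a n, q = loc_frac a n.
Proof. by elim/quotW: q => -[a n]; exists a, n. Qed.

Lemma loc_frac_eq a n b m : loc_frac a n = loc_frac b m <->
  exists k, f ^+ k * (a * f ^+ m) = f ^+ k * (b * f ^+ n).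
Proof.
split=> [/eqP|e]; first by rewrite /loc_frac eqmodE => /asboolP.
by apply/eqP; rewrite /loc_frac eqmodE; apply/asboolP.
Qed.

Definition loc_add (p q : localization) : localization :=
  let x := repr p in let y := repr q in
  loc_frac (x.1 * f ^+ y.2 + y.1 * f ^+ x.2) (x.2 + y.2).
Definition loc_opp (p : localization) : localization :=
  let x := repr p in loc_frac (- x.1) x.2.
Definition loc_mul (p q : localization) : localization :=
  let x := repr p in let y := repr q in loc_frac (x.1 * y.1) (x.2 + y.2).
Definition loc_scale (c : R) (p : localization) : localization :=
  let x := repr p in loc_frac (c * x.1) x.2.

Let reprP a n : exists k, f ^+ k * ((repr (loc_frac a n)).1 * f ^+ n) =
  f ^+ k * (a * f ^+ (repr (loc_frac a n)).2).
Proof. by apply/loc_frac_eq; rewrite /loc_frac -surjective_pairing reprK. Qed.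

Lemma loc_addE a n b m : loc_add (loc_frac a n) (loc_frac b m) =
  loc_frac (a * f ^+ m + b * f ^+ n) (n + m).
Proof.
rewrite /loc_add; case: (reprP a n) (reprP b m) => k.
case: (repr _) => a' n' /= ea [l]; case: (repr _) => b' m' /= eb.
apply/loc_frac_eq; exists (k + l)%N; rewrite !exprD.
transitivity (f ^+ l * f ^+ m * f ^+ m' * (f ^+ k * (a' * f ^+ n))
  + f ^+ k * f ^+ n * f ^+ n' * (f ^+ l * (b' * f ^+ m))); first by ring.
by rewrite ea eb; ring.
Qed.

Lemma loc_oppE a n : loc_opp (loc_frac a n) = loc_frac (- a) n.
Proof.
rewrite /loc_opp; case: (reprP a n) => k; case: (repr _) => a' n' /= ea.
by apply/loc_frac_eq; exists k; rewrite !mulNr !mulrN ea.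
Qed.

Lemma loc_mulE a n b m : loc_mul (loc_frac a n) (loc_frac b m) =
  loc_frac (a * b) (n + m).
Proof.
rewrite /loc_mul; case: (reprP a n) (reprP b m) => k.
case: (repr _) => a' n' /= ea [l]; case: (repr _) => b' m' /= eb.
apply/loc_frac_eq; exists (k + l)%N; rewrite !exprD.
transitivity ((f ^+ k * (a' * f ^+ n)) * (f ^+ l * (b' * f ^+ m))); first by ring.
by rewrite ea eb; ring.
Qed.

Lemma loc_scaleE c a n : loc_scale c (loc_frac a n) = loc_frac (c * a) n.
Proof.
rewrite /loc_scale; case: (reprP a n) => k; case: (repr _) => a' n' /= ea.
apply/loc_frac_eq; exists k.
transitivity (c * (f ^+ k * (a' * f ^+ n))); first by ring.
by rewrite ea; ring.
Qed.

Let locE := (loc_addE, loc_oppE, loc_mulE, loc_scaleE).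

Ltac loc_solve :=
  repeat match goal with
    | q : localization |- _ => case: (loc_fracP q) => ? [? ->]; clear q
  end; rewrite ?locE; apply/loc_frac_eq; exists 0%N; rewrite ?exprD; ring.

Fact loc_addA : associative loc_add. Proof. move=> p q r; loc_solve. Qed.
Fact loc_addC : commutative loc_add. Proof. move=> p q; loc_solve. Qed.
Fact loc_add0 : left_id (loc_frac 0 0) loc_add. Proof. move=> p; loc_solve. Qed.
Fact loc_addN : left_inverse (loc_frac 0 0) loc_opp loc_add.
Proof. move=> p; loc_solve. Qed.

HB.instance Definition _ :=
  GRing.isZmodule.Build localization loc_addA loc_addC loc_add0 loc_addN.

Fact loc_mulA : associative loc_mul. Proof. move=> p q r; loc_solve. Qed.
Fact loc_mulC : commutative loc_mul. Proof. move=> p q; loc_solve. Qed.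
Fact loc_mul1 : left_id (loc_frac 1 0) loc_mul. Proof. move=> p; loc_solve. Qed.
Fact loc_mulDl : left_distributive loc_mul loc_add.
Proof. move=> p q r; loc_solve. Qed.

HB.instance Definition _ :=
  GRing.Zmodule_isComPzRing.Build localization loc_mulA loc_mulC loc_mul1 loc_mulDl.

Fact loc_scaleA a b p : loc_scale a (loc_scale b p) = loc_scale (a * b) p.
Proof. loc_solve. Qed.
Fact loc_scale1 : left_id 1 loc_scale. Proof. move=> p; loc_solve. Qed.
Fact loc_scaleDr : right_distributive loc_scale +%R.
Proof. move=> a p q; rewrite /GRing.add /=; loc_solve. Qed.
Fact loc_scaleDl p : {morph loc_scale^~ p : a b / a + b}.
Proof. move=> a b /=; rewrite [RHS]/GRing.add /=; loc_solve. Qed.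

HB.instance Definition _ := GRing.Zmodule_isLmodule.Build R localization
  loc_scaleA loc_scale1 loc_scaleDr loc_scaleDl.

Lemma loc_fracV n : loc_frac (f ^+ n) 0 * loc_frac 1 n = 1.
Proof.
rewrite [LHS]loc_mulE; apply/loc_frac_eq; exists 0%N.
by rewrite !expr0 !mulr1 !mul1r.
Qed.

Lemma loc_scale_mul c (q : localization) : c *: q = loc_frac c 0 * q.
Proof.
by case: (loc_fracP q) => a [n ->]; rewrite [LHS]loc_scaleE [RHS]loc_mulE.
Qed.

End Localization.

Section Modules.
Variable R : comNzRingType.

Definition short_exact (L M N : lmodType R)
    (i : {linear L -> M}) (p : {linear M -> N}) : Prop :=
  [/\ injective i, (forall x, p x = 0 <-> exists y, i y = x)
    & forall z, exists x, p x = z].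

Definition splits (M N : lmodType R) (p : {linear M -> N}) : Prop :=
  exists s : {linear N -> M}, cancel s p.

Definition decomposable (M : lmodType R) : Prop :=
  exists (B C : lmodType R) (g : {linear (B * C)%type -> M}),
    [/\ (exists b : B, b != 0), (exists c : C, c != 0) & bijective g].

End Modules.

(* Main.v *)
From HB Require Import structures.
Require Import Defs.
From mathcomp Require Import all_boot all_algebra.
From mathcomp Require Import classical_sets.
From mathcomp Require Import boolp.
From mathcomp Require Import ring.

Local Open Scope ring_scope.

Import GRing.Theory.

(** If f is a unit then R_f = R is free; otherwise f lies in the maximal ideal.
    Write [e = i 1]. Since R_f is f-divisible, A = R e + f A. Applying the two
    projections of A = B (+) C to [e], locality of R shows that [e] agrees, up
    to a unit and modulo f A, with its component in one summand, say B; then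
    C = f C. Nakayama's lemma applied to [{r | r e \in C}] gives C \cap R e = 0,
    so [p] is injective on C, and [p C] contains some [a != 0]. Nakayama's lemma
    applied to the ideal [{s | s e \in a A + C}] = a R then gives A = R e + C, by
    torsion-freeness of A / C. So [p] maps C isomorphically onto R_f. *)

(** * Nonunits, Nakayama's lemma and a splitting criterion *)

(** Zorn's lemma for the ideals that contain [x] but not 1; the principal ideal of [x] is one of
    them because [x] is not a unit. *)
Lemma nonunit_in_maximal (R : comUnitRingType) (x : R) :
  x \isn't a GRing.unit -> exists2 m : set R, is_maximal_ideal m & m x.
Proof.
move=> xNU.
pose proper (J : set R) := [/\ is_ideal J, J x & ~ J 1].
have proper_x : proper [set y | exists c, y = c * x]%classic.
  split; first 1 last.
  - by exists 1; rewrite mul1r.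
  - by case=> c c1; case/negP: xNU; apply/unitrP; exists c; rewrite -c1 mulrC.
  split; first by exists 0; rewrite mul0r.
  - by move=> _ _ [c ->] [d ->]; exists (c + d); rewrite mulrDl.
  - by move=> a _ [c ->]; exists (a * c); rewrite mulrA.
(* The union of the empty chain is not an ideal, whence the extra disjunct. *)
have [|M [M0P Mmax]] := @Zorn_bigcup R [set J | J = set0 \/ proper J]%classic.
  move=> F FP Ftot /=.
  have [[J FJ JP]|noJ] := pselect (exists2 J, F J & proper J); last first.
    left; apply/seteqP; split=> [y [J FJ Jy]|//].
    by case: (FP _ FJ) => [J0|JP]; [rewrite J0 in Jy|case: noJ; exists J].
  right; split.
  - have [[J0 _ _] Jx _] := JP; split; first by exists J.
    + move=> y z [K FK Ky] [L FL Lz].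
      have Fid I t : F I -> I t -> is_ideal I by move=> /FP[->|[]].
      case: (Ftot _ _ FK FL) => [KL|LK].
      * have [_ LD _] := Fid _ _ FL Lz.
        by exists L => //; apply: LD => //; apply: KL.
      * have [_ KD _] := Fid _ _ FK Ky.
        by exists K => //; apply: KD => //; apply: LK.
    + move=> a y [K FK Ky]; exists K => //.
      by case: (FP _ FK) => [K0|[[_ _ KM] _ _]]; [rewrite K0 in Ky|apply: KM].
  - by exists J => //; case: JP.
  - by case=> K FK K1; case: (FP _ FK) => [K0|[]//]; rewrite K0 in K1.
(* The alternative [M = set0] contradicts maximality, since the principal ideal of [x] is strictly
   larger. *)
have {M0P} [Mid Mx M1] : proper M.
  case: M0P => // M0.
  case: (Mmax [set y | exists c, y = c * x]%classic); last by right.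
  rewrite M0; split=> [//|sub].
  by have := sub x; apply; exists 1; rewrite mul1r.
exists M => //; split=> // [MT|J Jid MJ]; first by apply: M1; rewrite MT.
have [J1|J1] := pselect (J 1).
  right; apply/seteqP; split=> // y _; rewrite -(mulr1 y).
  by have [_ _] := Jid; apply.
left; apply/seteqP; split=> //; apply: contrapT => nJM.
by apply: (Mmax J) => //; right; split=> //; apply: MJ.
Qed.

Lemma local_ring_nonunitP (R : comUnitRingType) (m : set R) (x : R) :
  is_local_ring m -> x \isn't a GRing.unit <-> m x.
Proof.
move=> [[mid mT _] muniq]; split=> [/nonunit_in_maximal[n /muniq <-]//|mx].
apply/negP => /unitrP[y [yx _]]; apply: mT; apply/seteqP; split=> // z _.
by have [_ _ mM] := mid; rewrite -(mulr1 z) -yx mulrA; apply: mM.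
Qed.

(** The units [1 - f * c] express that [f] lies in the Jacobson radical. Modulo [J], each generator
    of [L] is a combination of the others, so generators can be discarded one at a time. *)
Lemma nakayama_ideal (R : comUnitRingType) (f : R) (L J : set R) :
    noetherian R -> (forall c, 1 - f * c \is a GRing.unit) ->
    is_ideal L -> is_ideal J ->
    (forall x, L x -> exists j l, [/\ J j, L l & x = j + f * l]) ->
  (L `<=` J)%classic.
Proof.
move=> Rnoeth fU Lid [J0 JD JM] LJ.
have [s Ls] := Rnoeth _ Lid.
have sL : {in s, forall x, L x}.
  move=> x /(nthP 0)[k ks <-]; rewrite Ls.
  exists (fun k' => (k' == Ordinal ks)%:R).
  rewrite (bigD1 (Ordinal ks)) //= eqxx mul1r big1 ?addr0// => k' /negPf ->.
  by rewrite mul0r.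
suff: forall x, L x -> exists2 j, J j & ideal_span [::] (x - j).
  move=> + x Lx => /(_ x Lx)[j Jj [c]]; rewrite big_ord0 => /eqP.
  by rewrite subr_eq0 => /eqP ->.
(* From here on [s] need only lie in [L] and generate it modulo [J]; this is the invariant of the
   induction, which ends at the empty list. *)
have: forall x, L x -> exists2 j, J j & ideal_span s (x - j).
  by move=> x Lx; exists 0 => //; rewrite subr0 -Ls.
elim: s sL {Ls} => [//|y s IHs] ysL Lspan.
apply: IHs => [x xs|x Lx]; first by apply: ysL; rewrite inE xs orbT.
have spanP z : L z -> exists j d (c : 'I_(size s) -> R),
    J j /\ z = j + d * y + \sum_(k < size s) c k * s`_k.
  move=> /Lspan[j Jj [c]]; rewrite big_ord_recl /= => e.
  exists j, (c ord0), (c \o lift ord0); split=> //.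
  by rewrite -addrA -e addrC subrK.
have [|j [l [Jj Ll yE]]] := LJ y; first by apply: ysL; rewrite mem_head.
have [j' [d [c [Jj' lE]]]] := spanP l Ll.
have [j2 [d2 [c2 [Jj2 xE]]]] := spanP x Lx.
(* Expanding [l] in [y = j + f * l] makes [y] reappear with coefficient [f * d]; moving that term to
   the left leaves the unit [u]. *)
set u := 1 - f * d.
have uyE : u * y = j + f * j' + \sum_(k < size s) (f * c k) * s`_k.
  rewrite /u mulrBl mul1r {1}yE lE !mulrDr mulr_sumr.
  under eq_bigr do rewrite mulrA.
  by ring.
have {}uyE : y = u^-1 * (j + f * j') + \sum_(k < size s) (u^-1 * (f * c k)) * s`_k.
  rewrite -[LHS](mulKr (fU d)) uyE mulrDr mulr_sumr.
  by under eq_bigr do rewrite mulrA.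
exists (j2 + d2 * (u^-1 * (j + f * j'))).
  by apply: (JD) => //; apply/JM/JM/JD/JM.
exists (fun k => d2 * (u^-1 * (f * c k)) + c2 k).
under eq_bigr do rewrite mulrDl -mulrA.
by rewrite big_split /= -mulr_sumr xE [in LHS]uyE; ring.
Qed.

(** The section is the inverse of [p] restricted to [C]. It is obtained by choice, and injectivity
    on [C] makes it linear. *)
Lemma splits_complement (R : comNzRingType) (M N : lmodType R)
    (p : {linear M -> N}) (C : M -> Prop) :
    (forall a x y, C x -> C y -> C (a *: x + y)) ->
    (forall x, C x -> p x = 0 -> x = 0) ->
    (forall z, exists2 x, C x & p x = z) ->
  splits p.
Proof.
move=> Clin Cinj surj.
have /boolp.choice[s /all_and2[Cs ps]] z : exists x, C x /\ p x = z.
  by have [x Cx px] := surj z; exists x.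
have injC x y : C x -> C y -> p x = p y -> x = y.
  move=> Cx Cy pxy; apply/eqP; rewrite -subr_eq0 addrC -scaleN1r; apply/eqP.
  by apply: Cinj; [apply: Clin|rewrite linearP pxy scaleN1r addNr].
have slin : linear s.
  move=> a x y; apply: injC; rewrite ?linearP ?ps//; exact: Clin.
pose sL := GRing.isLinear.Build _ _ _ _ s slin.
by exists (HB.pack_for {linear N -> M} s sL) => x; apply: ps.
Qed.

(** * Torsion, divisibility and denominators in [R_f] *)

Section LocalizationModule.
Context {R : idomainType} {f : R} (f_neq0 : f != 0).

Lemma loc_scale_eq0 (a : R) (q : localization f) :
  a != 0 -> a *: q = 0 -> q = 0.
Proof.
move=> a0; case: (loc_fracP q) => b [n ->].
rewrite [_ *: _]loc_scaleE => /loc_frac_eq[k]; rewrite mul0r expr0 mulr1 mulr0.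
move=> /eqP; rewrite !mulf_eq0 expf_eq0 (negPf f_neq0) andbF (negPf a0) /=.
move=> /eqP ->; apply/loc_frac_eq; exists 0%N; ring.
Qed.

Lemma loc_divisible (n : nat) (q : localization f) : exists q', q = f ^+ n *: q'.
Proof.
case: (loc_fracP q) => b [k ->]; exists (loc_frac f b (k + n)).
rewrite [RHS]loc_scaleE; apply/loc_frac_eq; exists 0%N; rewrite exprD; ring.
Qed.

Lemma loc_denominator (q : localization f) :
  exists n a, f ^+ n *: q = a *: loc_frac f 1 0.
Proof.
case: (loc_fracP q) => b [k ->]; exists k, b.
rewrite [LHS]loc_scaleE [RHS]loc_scaleE; apply/loc_frac_eq; exists 0%N; ring.
Qed.

End LocalizationModule.

(** * The middle term of the extension *)

Section Extension.
Context {R : idomainType} {f : R} {A : lmodType R}.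
Context {i : {linear R^o -> A}} {p : {linear A -> localization f}}.
Hypotheses (f_neq0 : f != 0) (ex : short_exact i p).

Let e : A := i 1.

Let iE r : i r = r *: e.
Proof. by rewrite /e -linearZ /= [_ *: 1]mulr1. Qed.

Let kerpP x : p x = 0 -> exists r, x = r *: e.
Proof. by have [_ kerp _] := ex => /kerp[r <-]; exists r. Qed.

Let pe r : p (r *: e) = 0.
Proof. by have [_ kerp _] := ex; apply/kerp; exists r. Qed.

Let e_inj r : r *: e = 0 -> r = 0.
Proof. by have [inj _ _] := ex; rewrite -iE => r0; apply: inj; rewrite r0 linear0. Qed.

(** Torsion-freeness passes from [R] and [R_f] to an extension of one by the other. *)
Lemma middle_torsion_free (a : R) (x : A) : a != 0 -> a *: x = 0 -> x = 0.
Proof.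
move=> a0 ax; have /kerpP[r rE] : p x = 0.
  by apply: (loc_scale_eq0 f_neq0 _ _ a0); rewrite -linearZ ax linear0.
move: ax; rewrite rE scalerA => /e_inj/eqP; rewrite mulf_eq0 (negPf a0) => /eqP ->.
by rewrite scale0r.
Qed.

Lemma middle_decomp (x : A) : exists r y, x = r *: e + f *: y.
Proof.
have [q pxE] := loc_divisible 1 (p x); have [_ _ /(_ q)[y yE]] := ex.
have /kerpP[r rE] : p (x - f *: y) = 0 by rewrite linearB linearZ yE pxE subrr.
by exists r, y; rewrite -rE subrK.
Qed.

Lemma splits_unit : f \is a GRing.unit -> splits p.
Proof.
move=> fU; have [_ _ psurj] := ex; have [x0 x0E] := psurj (loc_frac f 1 0).
(* Here [R_f] is free on 1, so the multiples of a lift [x0] of 1 form the complement. *)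
apply: (splits_complement _ _ _ p (fun x => exists r, x = r *: x0)).
- move=> a _ _ [r ->] [r' ->]; exists (a * r + r').
  by rewrite scalerDl scalerA.
- move=> _ [r ->]; rewrite linearZ /= x0E => r0.
  have [->|/(loc_scale_eq0 f_neq0)/(_ r0)] := eqVneq r 0; first exact: scale0r.
  move=> /loc_frac_eq[k] /eqP; rewrite !expr0 !mulr1 mulr0.
  by rewrite expf_eq0 (negPf f_neq0) andbF.
- move=> z; have [n [a aE]] := loc_denominator z.
  exists ((f ^- n * a) *: x0); first by exists (f ^- n * a).
  by rewrite linearZ /= x0E -scalerA -aE scalerA mulVr ?scale1r ?unitrX.
Qed.

(** * Splitting from an [f]-divisible summand *)

Section DivisibleSummand.
(** The summand enters only as the kernel of [u]: [u_pure] says that its quotient is torsion-free,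
    [u_div] that it equals [f] times itself. *)
Context (U : lmodType R) (u : {linear A -> U}).
Hypothesis Rnoeth : noetherian R.
Hypothesis fU : forall c, 1 - f * c \is a GRing.unit.
Hypothesis u_pure : forall (a : R) x, a != 0 -> u (a *: x) = 0 -> u x = 0.
Hypothesis u_div : forall x, u x = 0 -> exists2 y, u y = 0 & x = f *: y.
Hypothesis u_ker : exists2 x, u x = 0 & x != 0.

(** If [x *: e = f *: y] with [y] in the kernel of [u], then [y] is in [R e], as [R_f] has no
    [f]-torsion. Hence [N = f N], and Nakayama's lemma with [J = 0] applies. *)
Let ker_e r : u (r *: e) = 0 -> r = 0.
Proof.
pose N := [set r | u (r *: e) = 0]%classic; pose Z := [set 0 : R]%classic.
have Nid : is_ideal N.
  split=> [|x y|a x]; rewrite /N /= ?scale0r ?linear0// => xN.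
  - by move=> yN; rewrite scalerDl linearD xN yN addr0.
  - by rewrite -scalerA linearZ /= xN scaler0.
have Zid : is_ideal Z.
  split=> // [x y|a x]; rewrite /Z /= => ->; first by move=> ->; rewrite addr0.
  by rewrite mulr0.
move=> ur; apply: (nakayama_ideal _ _ N Z Rnoeth fU Nid Zid) => // x Nx.
have [y uy xE] := u_div _ Nx; have /kerpP[s sE] : p y = 0.
  by apply: (loc_scale_eq0 f_neq0 _ _ f_neq0); rewrite -linearZ -xE pe.
exists 0, s; split=> //; first by rewrite /N /= -sE.
by apply/eqP; rewrite add0r -subr_eq0; apply/eqP/e_inj;
  rewrite scalerBl xE -scalerA -sE subrr.
Qed.

Let p_inj x : u x = 0 -> p x = 0 -> x = 0.
Proof. by move=> ux /kerpP[r rE]; move: ux; rewrite rE => /ker_e ->; rewrite scale0r. Qed.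

Let u_divX n x : u x = 0 -> exists2 y, u y = 0 & x = f ^+ n *: y.
Proof.
elim: n x => [|n IHn] x ux; first by exists x; rewrite ?scale1r.
have [y uy ->] := u_div _ ux; have [z uz ->] := IHn _ uy.
by exists z; rewrite // scalerA exprS.
Qed.

Lemma splits_divisible_summand : splits p.
Proof.
apply: (splits_complement _ _ _ p (fun x => u x = 0)) => //.
  by move=> a x y ux uy; rewrite linearP ux uy scaler0 addr0.
(* A nonzero element of the kernel of [u] has nonzero image under [p]; clearing its denominator
   gives [a]. *)
have [a a0 [c0 uc0 pc0]] : exists2 a : R, a != 0 &
    exists2 c, u c = 0 & p c = a *: loc_frac f 1 0.
  have [x ux x0] := u_ker; have [n [a aE]] := loc_denominator (p x).
  exists a; last by exists (f ^+ n *: x); rewrite linearZ /= ?ux ?scaler0.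
  apply: contra x0 => /eqP a0; apply/eqP/p_inj => //.
  apply: (loc_scale_eq0 f_neq0 (f ^+ n)); first by rewrite expf_neq0.
  by rewrite aE a0 scale0r.
(* Dividing [c0] by powers of [f] inside the kernel of [u] reaches every [a / f ^+ n], so the image
   of this kernel contains [a R_f]. *)
have a_mul x : exists c s, u c = 0 /\ a *: x = c + s *: e.
  have [n [r rE]] := loc_denominator (p x).
  have [c uc cE] := u_divX n _ uc0.
  have /kerpP[s sE] : p (a *: x - r *: c) = 0.
    apply: (loc_scale_eq0 f_neq0 (f ^+ n)); first by rewrite expf_neq0.
    rewrite linearB ![p (_ *: _)]linearZ /= scalerBr !scalerA.
    rewrite [_ * a]mulrC [_ * r]mulrC -!scalerA rE -[f ^+ n *: p c]linearZ -cE.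
    by rewrite [p c0]pc0 !scalerA mulrC subrr.
  exists (r *: c), s; rewrite -sE addrC subrK; split=> //.
  by rewrite linearZ /= uc scaler0.
pose L := [set s | exists x c, u c = 0 /\ a *: x = c + s *: e]%classic.
pose J := [set s | exists t, s = a * t]%classic.
have Lid : is_ideal L.
  split.
  - by exists 0, 0; rewrite linear0 !scaler0 scale0r addr0.
  - move=> s t [x [c [uc xE]]] [y [d [ud yE]]]; exists (x + y), (c + d).
    by rewrite linearD uc ud addr0 scalerDr xE yE scalerDl addrACA.
  - move=> b s [x [c [uc xE]]]; exists (b *: x), (b *: c).
    by rewrite linearZ /= uc scaler0 scalerA mulrC -scalerA xE scalerDr scalerA.
have Jid : is_ideal J.
  split; first by exists 0; rewrite mulr0.
  - by move=> _ _ [s ->] [t ->]; exists (s + t); rewrite mulrDr.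
  - by move=> b _ [s ->]; exists (b * s); rewrite mulrCA.
have LJ : (L `<=` J)%classic.
  apply: (nakayama_ideal _ _ L J Rnoeth fU Lid Jid) => s [x [c [uc xE]]].
  have [r [y yE]] := middle_decomp x; have [d [s' [ud dE]]] := a_mul y.
  exists (a * r), s'; split; [by exists r|by exists y, d|].
  (* Writing [a *: x] in two ways shows that [(s - (a * r + f * s')) *: e] equals [f *: d - c],
     which [u] kills. *)
  apply/eqP; rewrite -subr_eq0; apply/eqP/ker_e.
  have key : (a * r) *: e + (f *: d + (f * s') *: e) = c + s *: e.
    by rewrite -xE yE -!scalerA -scalerDr -dE scalerDr !scalerA [f * a]mulrC.
  have -> : (s - (a * r + f * s')) *: e = f *: d - c.
    rewrite scalerBl scalerDl -[s *: e](addKr c) -key.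
    by rewrite [_ + (f *: d + _)]addrCA [- c + _]addrC addrAC addrK.
  by rewrite linearB linearZ /= uc ud scaler0 subrr.
have [_ _ psurj] := ex => z; have [x <-] := psurj z.
have [c [s [uc xE]]] := a_mul x; have [|t tE] := LJ s; first by exists x, c.
(* Now [a *: (x - t *: e) = c] lies in the kernel of [u], and purity cancels [a]. *)
exists (x - t *: e); last by rewrite linearB pe subr0.
by apply: (u_pure _ _ a0); rewrite scalerBr xE scalerA tE addrK.
Qed.

End DivisibleSummand.

(** * From a direct sum decomposition to a divisible summand *)

(** The maps [u] and [v] are the projections of a direct sum, described symmetrically so that the
    summands can be exchanged. Since [r] is a unit, [v e] is divisible by [f], hence so is all of
    [V], which is isomorphic to the kernel of [u]. *)
Lemma splits_summand (U V : lmodType R) (u : {linear A -> U}) (v : {linear A -> V})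
    (r : R) (y : A) :
    noetherian R -> (forall c, 1 - f * c \is a GRing.unit) ->
    (forall b c, exists2 x, u x = b & v x = c) ->
    (forall x, u x = 0 -> v x = 0 -> x = 0) -> (exists c : V, c != 0) ->
    r \is a GRing.unit -> v (r *: e + f *: y) = 0 ->
  splits p.
Proof.
move=> Rnoeth fU uv_surj uv_inj [c c0] rU vy.
apply: (splits_divisible_summand U u Rnoeth fU).
(* The component [w] of [x] in the kernel of [v] has the same image under [u], and [A] is
   torsion-free. *)
- move=> a x a0; rewrite linearZ => aux; have [w uw vw] := uv_surj (u x) 0.
  suff w0 : w = 0 by rewrite -uw w0 linear0.
  apply: (middle_torsion_free _ _ a0).
  by apply: uv_inj; rewrite linearZ /= ?uw ?vw ?scaler0.
- have [w0 veE] : exists w0, v e = f *: v w0.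
    exists (- r^-1 *: y).
    move: vy; rewrite linearD !linearZ /= => /eqP; rewrite addr_eq0 => /eqP vy.
    rewrite -[LHS]scale1r -(mulVr rU) -scalerA vy linearZ /= scaleNr.
    by rewrite !scalerN !scalerA mulrC.
  move=> x ux; have [s [z xE]] := middle_decomp x.
  have [w uw vw] := uv_surj 0 (s *: v w0 + v z).
  exists w => //; apply/eqP; rewrite -subr_eq0; apply/eqP/uv_inj.
    by rewrite linearB linearZ /= ux uw scaler0 subr0.
  rewrite linearB linearZ /= vw xE (linearD v) !(linearZ_LR v) veE.
  by rewrite scalerDr !scalerA [s * f]mulrC subrr.
- have [x ux vx] := uv_surj 0 c; exists x => //.
  by apply: contra c0 => /eqP x0; rewrite -vx x0 linear0.
Qed.

End Extension.

Theorem proposition1p11 (R : idomainType) (m : set R)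
    (R_noetherian : noetherian R) (R_local : is_local_ring m)
    (f : R) (f_neq0 : f != 0) (A : lmodType R)
    (i : {linear R^o -> A}) (p : {linear A -> localization f})
    (zeta_exact : short_exact i p) (A_decomposable : decomposable A) :
  splits p.
Proof.
have [fU|fNU] := boolP (f \is a GRing.unit).
  exact: (splits_unit f_neq0 zeta_exact).
have [[[_ mD mM] _ _] _] := R_local.
have mf : m f by apply/(local_ring_nonunitP R m f R_local).
have m1 : ~ m 1.
  by move=> /(local_ring_nonunitP R m 1 R_local); rewrite unitr1.
have fU c : 1 - f * c \is a GRing.unit.
  apply: contrapT => /negP /(local_ring_nonunitP R m _ R_local) mfc; apply: m1.
  by rewrite -[1](subrK (f * c)); apply: mD => //; rewrite mulrC; apply: mM.
have [B [C [g [B0 C0 [h gK hK]]]]] := A_decomposable.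
pose hL := GRing.isLinear.Build _ _ _ _ h (can2_linear gK hK).
pose H := HB.pack_for {linear A -> (B * C)%type} h hL.
pose u : {linear A -> B} := fst \o H; pose v : {linear A -> C} := snd \o H.
have uv_surj b c : exists2 x, u x = b & v x = c.
  by exists (g (b, c)); rewrite /u /v /= gK.
have uv_inj x : u x = 0 -> v x = 0 -> x = 0.
  move=> ux vx; rewrite -(hK x) (surjective_pairing (h x)).
  by rewrite [(h x).1]ux [(h x).2]vx linear0.
pose e : A := i 1.
(* Both components of [e] are reduced to multiples of [e] modulo [f A]; locality will force [r] or
   [s] to be a unit. *)
have [r [y bE]] := middle_decomp zeta_exact (g (u e, 0)).
have [s [z cE]] := middle_decomp zeta_exact (g (0, v e)).
have [rU|rNU] := boolP (r \is a GRing.unit).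
  apply: (splits_summand f_neq0 zeta_exact B C u v r y) => //.
  by rewrite -bE /v /= gK.
have [sU|sNU] := boolP (s \is a GRing.unit).
  apply: (splits_summand f_neq0 zeta_exact C B v u s z) => //.
  - by move=> b c; have [x] := uv_surj c b; exists x.
  - by move=> x ux vx; apply: uv_inj.
  - by rewrite -cE /u /= gK.
(* With [r] and [s] both nonunits, adding the components shows that [f *: (y + z)] is in [R e]. As
   [R_f] has no [f]-torsion, [y + z = t *: e], and comparing coefficients puts [1 = r + s + f * t]
   in [m]. *)
case: m1; have eE : e = (r + s) *: e + f *: (y + z).
  rewrite scalerDl scalerDr addrACA -bE -cE -linearD -{1}(hK e).
  congr (g _); rewrite {1}(surjective_pairing (h e)).
  by congr pair; rewrite ?addr0 ?add0r.
have [iinj kerp _] := zeta_exact.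
have iE t : i t = t *: e by rewrite /e -linearZ /= [_ *: 1]mulr1.
have [t tE] : exists t, i t = y + z.
  apply/kerp; apply: (loc_scale_eq0 f_neq0 f) => //.
  rewrite -linearZ; apply/kerp; exists (1 - (r + s)).
  by rewrite iE scalerBl scale1r {1}eE addrC addKr.
have -> : 1 = r + s + f * t.
  by apply: iinj; rewrite !iE scale1r scalerDl -scalerA -[t *: e]iE tE.
have mr : m r by apply/(local_ring_nonunitP R m r R_local).
have ms : m s by apply/(local_ring_nonunitP R m s R_local).
by apply: (mD); [apply: mD|rewrite mulrC; apply: mM].
Qed.
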